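(* Let $n\neq-1,0$ be real and $\mu=-\frac{3n+4}{n}$. The point transformation $$x'=\frac1x,\qquad t'=t,\qquad u'=x^{-\frac4n}u$$ generates a cyclic group of order $2$ and maps the equation $$u_t=\left(u^nu_x\right)_x+\frac{\mu}{x}u^nu_x$$ into itself (that is, into the same equation for $u'(x',t')$).
   Context: Subscripts denote partial derivatives. A point transformation $x'=P(x,t)$, $t'=Q(t)$, $u'=R(x,t,u)$ ''maps an equation $E'$ for $u'(x',t')$ into an equation $E$ for $u(x,t)$'' if: whenever $(x,t)\mapsto(P(x,t),Q(t))$ is a diffeomorphism of an open set $D\subset\{x>0\}$ onto an open set $D'$, $u$ is a smooth positive function on $D$, and $u'$ is defined on $D'$ by $u'(P(x,t),Q(t))=R(x,t,u(x,t))$, then $u'$ satisfies $E'$ on $D'$ if and only if $u$ satisfies $E$ on $D$. The transformation generates a cyclic group of order 2 if it is not the identity and its composition with itself is the identity on $\{(x,t,u):x>0,\ u>0\}$. *)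

(* Defs.v *)
(* Real numbers of the Stdlib, with Coquelicot's derivatives. *)
From Stdlib Require Import Reals.
From Coquelicot Require Import Coquelicot.
Open Scope R_scope.

(* Functions defined on an open set D are represented by total functions;
   only their values on D matter. *)

Definition Dx (f : R -> R -> R) (x t : R) : R := Derive (fun z => f z t) x.
Definition Dt (f : R -> R -> R) (x t : R) : R := Derive (fun s => f x s) t.

(* [ex_diff_n f k x t]: the iterated partial derivatives of f up to order k,
   in any order of differentiation, exist and are continuous at (x, t);
   hence, for open D, [smooth_on D f] is C^infinity smoothness on D. *)
Definition smooth_on (D : R * R -> Prop) (f : R -> R -> R) : Prop :=
  forall x t, D (x, t) -> forall k : nat, ex_diff_n f k x t.

Definition positive_on (D : R * R -> Prop) (f : R -> R -> R) : Prop :=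
  forall x t, D (x, t) -> 0 < f x t.

(* (x, t) |-> (F x t, G x t) is a diffeomorphism of D onto D', with inverse
   (y, s) |-> (A y s, B y s). *)
Definition diffeomorphism (D D' : R * R -> Prop) (F G : R -> R -> R) : Prop :=
  smooth_on D F /\ smooth_on D G /\
  (forall x t, D (x, t) -> D' (F x t, G x t)) /\
  exists A B : R -> R -> R,
    smooth_on D' A /\ smooth_on D' B /\
    (forall y s, D' (y, s) -> D (A y s, B y s)) /\
    (forall x t, D (x, t) ->
       A (F x t) (G x t) = x /\ B (F x t) (G x t) = t) /\
    (forall y s, D' (y, s) ->
       F (A y s) (B y s) = y /\ G (A y s) (B y s) = s).

(* x' = PT_x x t,  t' = PT_t t,  u' = PT_u x t u *)
Record point_transformation := PointTransformation {
  PT_x : R -> R -> R;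
  PT_t : R -> R;
  PT_u : R -> R -> R -> R
}.

Definition PT_apply (T : point_transformation) (p : R * R * R) : R * R * R :=
  let '(x, t, u) := p in (PT_x T x t, PT_t T t, PT_u T x t u).

Definition PT_domain (p : R * R * R) : Prop :=
  let '(x, t, u) := p in 0 < x /\ 0 < u.

(* The first clause makes the composition of T with itself meaningful on
   the domain. *)
Definition generates_cyclic_group_of_order_2 (T : point_transformation) : Prop :=
  (forall p, PT_domain p -> PT_domain (PT_apply T p)) /\
  (exists p, PT_domain p /\ PT_apply T p <> p) /\
  (forall p, PT_domain p -> PT_apply T (PT_apply T p) = p).

(* An equation is given by its pointwise validity: [E u x t] says that it
   holds for u at (x, t). *)
Definition equation := (R -> R -> R) -> R -> R -> Prop.

(* [Derive] and [Rpower] are total, so a solution is required to be smooth and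
   positive: this is what makes the derivatives and real powers in the
   equation genuine. *)
Definition satisfies_on (D : R * R -> Prop) (E : equation) (u : R -> R -> R)
  : Prop :=
  smooth_on D u /\ positive_on D u /\ forall x t, D (x, t) -> E u x t.

Definition maps_equation_into (T : point_transformation) (E' E : equation)
  : Prop :=
  forall (D D' : R * R -> Prop) (u u' : R -> R -> R),
    open D -> open D' ->
    (forall x t, D (x, t) -> 0 < x) ->
    diffeomorphism D D' (PT_x T) (fun _ t => PT_t T t) ->
    smooth_on D u -> positive_on D u ->
    (forall x t, D (x, t) -> u' (PT_x T x t) (PT_t T t) = PT_u T x t (u x t)) ->
    (satisfies_on D' E' u' <-> satisfies_on D E u).

(* u_t = (u^n u_x)_x + (mu / x) u^n u_x *)
Definition diffusion_equation (n mu : R) : equation := fun u x t =>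
  Dt u x t =
    Dx (fun y s => Rpower (u y s) n * Dx u y s) x t
    + mu / x * Rpower (u x t) n * Dx u x t.

Definition inversion (n : R) : point_transformation :=
  PointTransformation
    (fun x _ => 1 / x)
    (fun t => t)
    (fun x _ u => Rpower x (- (4 / n)) * u).

(* Main.v *)
Require Import Defs.
From Stdlib Require Import Reals Lra.
From Coquelicot Require Import Coquelicot.
Open Scope R_scope.

(** Put a = 4 / n and v(y, t) = y^a u(1/y, t).  Then mu = - (3 + a), and the
    flux of v is v^n v_y = a y^(a+3) u^(n+1) - y^(a+2) u^n u_x, with u taken at
    (1/y, t).  Differentiating once more, the terms in u^(n+1) of
    (v^n v_y)_y + (mu/y) v^n v_y have the factor a (a + 3 + mu) = 0, and those in
    u^n u_x have the coefficient - (a (n+1) + a + 2 + mu) = mu; what remains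
    is y^a times the right-hand side of the equation for u at x = 1/y
    ([spatial_operator_inversion]).  As v_t = y^a u_t, the function v solves
    the equation at (y, t) if and only if u does at (1/y, t).

    Every expression in this computation has the form c y^b g(1/y), and
    differentiation turns such a function into a sum of two others
    ([is_derive_weighted_inversion]).  The same fact gives, by
    induction on the order of differentiation, the smoothness of v
    ([ex_diff_n_weighted_inversion]).

    Since the transformation is an involution, the implication from u to v also
    yields the converse, with the two domains exchanged. *)

(** * Real powers and inversion *)

Lemma Rpower_inv (x b : R) : 0 < x -> Rpower (1 / x) (- b) = Rpower x b.
Proof.
  intros Hx. unfold Rpower, Rdiv. rewrite Rmult_1_l, ln_Rinv by exact Hx.
  f_equal; ring.
Qed.

Lemma Rpower_plus_nat (x b : R) (k : nat) :
  0 < x -> Rpower x (b + INR k) = Rpower x b * x ^ k.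
Proof.
  intros Hx. rewrite Rpower_plus, Rpower_pow by exact Hx. reflexivity.
Qed.

Lemma Rpower_pos (x b : R) : 0 < Rpower x b.
Proof. apply exp_pos. Qed.

Lemma one_div_pos (x : R) : 0 < x -> 0 < 1 / x.
Proof. intros Hx. apply Rdiv_lt_0_compat; lra. Qed.

Lemma one_div_involutive (x : R) : 0 < x -> 1 / (1 / x) = x.
Proof. intros Hx. field. lra. Qed.

Lemma is_derive_Rpower (f : R -> R) (x l b : R) :
  0 < f x -> is_derive f x l ->
  is_derive (fun z => Rpower (f z) b) x (b * Rpower (f x) (b - 1) * l).
Proof.
  intros Hx Hf. unfold Rpower at 1.
  assert (HD : ex_derive f x) by (exists l; exact Hf).
  auto_derive; [ tauto |].
  replace (Derive (fun z : R => f z) x) with l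
    by (symmetry; exact (is_derive_unique f x l Hf)).
  unfold Rminus. rewrite Rpower_plus, Rpower_Ropp, Rpower_1 by exact Hx.
  unfold Rpower. field. lra.
Qed.

(** * Functions of the form c y^b g(1/y) *)

Definition weighted_inversion (c b : R) (g : R -> R) (y : R) : R :=
  c * Rpower y b * g (1 / y).

(** The family is closed under differentiation, up to sums, because
    (1/y)' = - y^(-2) is again a multiple of a power of y. *)
Lemma is_derive_weighted_inversion (c b : R) (g : R -> R) (y l : R) :
  0 < y -> is_derive g (1 / y) l ->
  is_derive (weighted_inversion c b g) y
    (c * b * Rpower y (b - 1) * g (1 / y) + - c * Rpower y (b - 2) * l).
Proof.
  intros Hy Hg.
  assert (Hw : is_derive (fun z => Rpower z b) y (b * Rpower y (b - 1) * 1)).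
  { apply (is_derive_Rpower (fun z => z)); [ exact Hy | apply (is_derive_id y) ]. }
  assert (Hi : is_derive (fun z => 1 / z) y (- / y ^ 2)).
  { auto_derive; [ lra | field; lra ]. }
  assert (Hc : is_derive (fun z => g (1 / z)) y (- / y ^ 2 * l))
    by exact (is_derive_comp g (fun z => 1 / z) y l _ Hg Hi).
  assert (Hm := is_derive_mult _ _ y _ _
                  (is_derive_scal _ y c _ Hw) Hc Rmult_comm).
  eapply is_derive_ext; [| evar_last; [ exact Hm |]].
  - intros z. reflexivity.
  - unfold plus, mult, scal; simpl; unfold mult; simpl.
    replace (Rpower y b) with (Rpower y (b - 2) * y ^ 2).
    + field. lra.
    + rewrite <- (Rpower_plus_nat y (b - 2) 2) by exact Hy.
      f_equal. simpl. ring.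
Qed.

(** * Smoothness under inversion *)

Lemma locally_2d_open (D : R * R -> Prop) (x t : R) :
  open D -> D (x, t) -> locally_2d (fun u v => D (u, v)) x t.
Proof.
  intros HD H. apply locally_2d_locally.
  apply (filter_imp D); [ intros [u v]; exact (fun h => h) | exact (HD _ H) ].
Qed.

Lemma locally_slice (D : R * R -> Prop) (x t : R) :
  open D -> D (x, t) -> locally x (fun z => D (z, t)).
Proof.
  intros HD H.
  exact (locally_2d_1d_const_y _ _ _ (locally_2d_open D x t HD H)).
Qed.

Lemma ex_diff_n_plus (D : R * R -> Prop) (k : nat) :
  open D -> forall f g : R -> R -> R,
  (forall x t, D (x, t) -> ex_diff_n f k x t) ->
  (forall x t, D (x, t) -> ex_diff_n g k x t) ->
  forall x t, D (x, t) -> ex_diff_n (fun x t => f x t + g x t) k x t.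
Proof.
  intros HD. induction k as [| k IH]; intros f g Hf Hg x t Hxt.
  - split; [ apply continuity_2d_pt_plus; [ apply Hf | apply Hg ]; exact Hxt
           | exact I ].
  - destruct (Hf x t Hxt) as [Cf [Xf [Tf _]]].
    destruct (Hg x t Hxt) as [Cg [Xg [Tg _]]].
    split; [ apply continuity_2d_pt_plus; assumption |].
    split; [ exact (ex_derive_plus (fun z => f z t) (fun z => g z t) x Xf Xg) |].
    split; [ exact (ex_derive_plus (fun z => f x z) (fun z => g x z) t Tf Tg) |].
    split.
    + apply (ex_diff_n_ext_loc (fun u v =>
               Derive (fun z => f z v) u + Derive (fun z => g z v) u)).
      * eapply locally_2d_impl; [| exact (locally_2d_open D x t HD Hxt) ].
        apply locally_2d_forall. intros u v Huv. symmetry.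
        apply (Derive_plus (fun z => f z v) (fun z => g z v));
          [ apply (Hf u v Huv) | apply (Hg u v Huv) ].
      * apply IH; [ intros a b Hab; apply (Hf a b Hab)
                  | intros a b Hab; apply (Hg a b Hab) | exact Hxt ].
    + apply (ex_diff_n_ext_loc (fun u v =>
               Derive (fun z => f u z) v + Derive (fun z => g u z) v)).
      * eapply locally_2d_impl; [| exact (locally_2d_open D x t HD Hxt) ].
        apply locally_2d_forall. intros u v Huv. symmetry.
        apply (Derive_plus (fun z => f u z) (fun z => g u z));
          [ apply (Hf u v Huv) | apply (Hg u v Huv) ].
      * apply IH; [ intros a b Hab; apply (Hf a b Hab)
                  | intros a b Hab; apply (Hg a b Hab) | exact Hxt ].
Qed.

Lemma continuity_2d_pt_weighted_inversion (f : R -> R -> R) (c b y s : R) :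
  0 < y -> continuity_2d_pt f (1 / y) s ->
  continuity_2d_pt (fun y s => weighted_inversion c b (fun z => f z s) y) y s.
Proof.
  intros Hy Hf. unfold weighted_inversion.
  apply (continuity_2d_pt_mult (fun y _ => c * Rpower y b)).
  - apply (continuity_1d_2d_pt_comp (fun y => c * Rpower y b) (fun y _ => y));
      [| apply continuity_2d_pt_id1 ].
    apply derivable_continuous_pt, ex_derive_Reals_0.
    apply (ex_derive_scal (fun z => Rpower z b)). eexists.
    apply (is_derive_Rpower (fun z => z)); [ exact Hy | apply (is_derive_id y) ].
  - apply continuity_2d_pt_filterlim.
    apply continuity_2d_pt_filterlim in Hf.
    apply (filterlim_comp_2 (F := locally (y, s))
             (G := locally (1 / y)) (H := locally s)
             (fun p : R * R => 1 / fst p) (fun p : R * R => snd p) f).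
    + apply (continuity_2d_pt_filterlim (fun y _ => 1 / y)).
      apply (continuity_1d_2d_pt_comp (fun y => 1 / y) (fun y _ => y));
        [| apply continuity_2d_pt_id1 ].
      apply derivable_continuous_pt, ex_derive_Reals_0.
      auto_derive. simpl. lra.
    + apply (continuity_2d_pt_filterlim (fun _ s => s)).
      apply continuity_2d_pt_id2.
    + intros P HP. specialize (Hf P HP). destruct Hf as [d Hd].
      exists (ball (1 / y) d) (ball s d); try apply locally_ball.
      intros u v Hu Hv. apply (Hd (u, v)). split; assumption.
Qed.

(** The induction must range over all c, b and f at once: the
    y-derivative combines the members with parameters (c b, b - 1, f) and
    (- c, b - 2, f_x). *)
Lemma ex_diff_n_weighted_inversion (D D' : R * R -> Prop) (k : nat) :
  open D' ->
  (forall y s, D' (y, s) -> 0 < y /\ D (1 / y, s)) ->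
  forall (f : R -> R -> R) (c b : R),
  (forall x t, D (x, t) -> ex_diff_n f k x t) ->
  forall y s, D' (y, s) ->
  ex_diff_n (fun y s => weighted_inversion c b (fun z => f z s) y) k y s.
Proof.
  intros HD' Hinv.
  induction k as [| k IH]; intros f c b Hf y s Hys;
    destruct (Hinv y s Hys) as [Hy HD]; destruct (Hf _ _ HD) as [Cf Rf];
    (split; [ exact (continuity_2d_pt_weighted_inversion f c b y s Hy Cf) |]).
  - exact I.
  - destruct Rf as [Xf [Tf _]].
    split.
    { eexists. apply is_derive_weighted_inversion; [ exact Hy |].
      apply Derive_correct. exact Xf. }
    split.
    { apply (ex_derive_scal (fun z => f (1 / y) z)). exact Tf. }
    split.
    + apply (ex_diff_n_ext_loc (fun u v =>
        weighted_inversion (c * b) (b - 1) (fun z => f z v) u +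
        weighted_inversion (- c) (b - 2)
          (fun z => Derive (fun w => f w v) z) u)).
      * eapply locally_2d_impl; [| exact (locally_2d_open D' y s HD' Hys) ].
        apply locally_2d_forall. intros u v Huv. symmetry.
        destruct (Hinv u v Huv) as [Hu HDu].
        apply (is_derive_unique (weighted_inversion c b (fun z => f z v))).
        apply is_derive_weighted_inversion; [ exact Hu |].
        apply Derive_correct. apply (Hf _ _ HDu).
      * apply (ex_diff_n_plus D' k HD'); [| | exact Hys ].
        -- apply IH. intros p q Hpq. apply (ex_diff_n_m (S k)); [ auto |].
           exact (Hf p q Hpq).
        -- apply (IH (fun z v => Derive (fun w => f w v) z)).
           intros p q Hpq. apply (Hf p q Hpq).
    + apply (ex_diff_n_ext_loc (fun u v =>
        weighted_inversion c b (fun z => Derive (fun w => f z w) v) u)).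
      * apply locally_2d_forall. intros u v. symmetry.
        apply (Derive_scal (fun w => f (1 / u) w)).
      * apply (IH (fun z v => Derive (fun w => f z w) v)); [| exact Hys ].
        intros p q Hpq. apply (Hf p q Hpq).
Qed.

(** * The right-hand side of the equation under inversion *)

Definition spatial_operator (n mu : R) (g : R -> R) (x : R) : R :=
  Derive (fun z => Rpower (g z) n * Derive g z) x
  + mu / x * Rpower (g x) n * Derive g x.

Lemma spatial_operator_ext_loc (n mu : R) (g h : R -> R) (x : R) :
  locally x (fun z => g z = h z) ->
  spatial_operator n mu g x = spatial_operator n mu h x.
Proof.
  intros H. unfold spatial_operator.
  rewrite (Derive_ext_loc g h x H), (locally_singleton _ _ H).
  f_equal. apply Derive_ext_loc.
  apply (filter_imp (fun z => locally z (fun w => g w = h w)));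
    [| exact (locally_locally _ _ H) ].
  intros z Hz. rewrite (Derive_ext_loc g h z Hz), (locally_singleton _ _ Hz).
  reflexivity.
Qed.

(** The choice a = 4 / n makes (y^a)^n = y^4, so that the flux is again a sum of
    weighted inversions. *)
Lemma flux_weighted_inversion (n : R) (g : R -> R) (y : R) :
  n <> 0 -> 0 < y -> 0 < g (1 / y) -> ex_derive g (1 / y) ->
  Rpower (weighted_inversion 1 (4 / n) g y) n
    * Derive (weighted_inversion 1 (4 / n) g) y
  = weighted_inversion (4 / n) (4 / n + 3) (fun z => Rpower (g z) (n + 1)) y
    + weighted_inversion (- 1) (4 / n + 2)
        (fun z => Rpower (g z) n * Derive g z) y.
Proof.
  intros Hn Hy Hg Dg.
  rewrite (is_derive_unique _ _ _
    (is_derive_weighted_inversion 1 (4 / n) g y _ Hy (Derive_correct _ _ Dg))).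
  unfold weighted_inversion. rewrite Rmult_1_l.
  rewrite <- Rpower_mult_distr by (exact Hg || apply Rpower_pos).
  rewrite Rpower_mult.
  replace (4 / n * n) with (INR 4) by (simpl; field; exact Hn).
  rewrite Rpower_pow by exact Hy.
  rewrite (Rpower_plus n 1), (Rpower_1 (g (1 / y))) by exact Hg.
  replace (4 / n - 1) with (4 / n - 2 + INR 1) by (simpl; ring).
  replace (4 / n + 3) with (4 / n - 2 + INR 5) by (simpl; ring).
  replace (4 / n + 2) with (4 / n - 2 + INR 4) by (simpl; ring).
  rewrite !Rpower_plus_nat by exact Hy.
  ring.
Qed.

(** The value of mu cancels the terms in g^(n+1) and turns the coefficient of
    g^n g' into mu itself. *)
Lemma spatial_operator_inversion (n : R) (g : R -> R) (y : R) :
  n <> 0 ->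
  locally y (fun z => 0 < z /\ 0 < g (1 / z) /\ ex_derive g (1 / z)) ->
  ex_derive (Derive g) (1 / y) ->
  spatial_operator n (- ((3 * n + 4) / n)) (weighted_inversion 1 (4 / n) g) y
  = Rpower y (4 / n) * spatial_operator n (- ((3 * n + 4) / n)) g (1 / y).
Proof.
  intros Hn Hloc D2g.
  destruct (locally_singleton _ _ Hloc) as [Hy [Hg Dg]].
  assert (D1 := Derive_correct _ _ Dg).
  set (phi := fun z => Rpower (g z) n * Derive g z).
  assert (Dphi : ex_derive phi (1 / y)).
  { apply (ex_derive_mult (fun z => Rpower (g z) n) (Derive g)); [| exact D2g ].
    eexists. exact (is_derive_Rpower g (1 / y) _ n Hg D1). }
  assert (Dpow := is_derive_Rpower g (1 / y) _ (n + 1) Hg D1).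
  replace (n + 1 - 1) with n in Dpow by ring.
  assert (Dflux :
    Derive (fun z => Rpower (weighted_inversion 1 (4 / n) g z) n
                     * Derive (weighted_inversion 1 (4 / n) g) z) y
    = Derive (fun z =>
        weighted_inversion (4 / n) (4 / n + 3) (fun w => Rpower (g w) (n + 1)) z
        + weighted_inversion (- 1) (4 / n + 2) phi z) y).
  { apply Derive_ext_loc. revert Hloc. apply filter_imp.
    intros z [Hz [Hgz Dgz]].
    exact (flux_weighted_inversion n g z Hn Hz Hgz Dgz). }
  assert (E := flux_weighted_inversion n g y Hn Hy Hg Dg).
  unfold spatial_operator at 1. rewrite Dflux, Rmult_assoc, E.
  assert (Dsum := is_derive_plus _ _ _ _ _
    (is_derive_weighted_inversion (4 / n) (4 / n + 3) _ y _ Hy Dpow)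
    (is_derive_weighted_inversion (- 1) (4 / n + 2) phi y _ Hy
       (Derive_correct _ _ Dphi))).
  apply is_derive_unique in Dsum. unfold plus in Dsum; simpl in Dsum.
  rewrite Dsum.
  unfold spatial_operator. fold phi.
  unfold weighted_inversion. change (phi (1 / y)) with
    (Rpower (g (1 / y)) n * Derive g (1 / y)).
  rewrite (Rpower_plus n 1), (Rpower_1 (g (1 / y))) by exact Hg.
  replace (4 / n + 3 - 1) with (4 / n + INR 2) by (simpl; ring).
  replace (4 / n + 3 - 2) with (4 / n + INR 1) by (simpl; ring).
  replace (4 / n + 2 - 1) with (4 / n + INR 1) by (simpl; ring).
  replace (4 / n + 2 - 2) with (4 / n + INR 0) by (simpl; ring).
  replace (4 / n + 3) with (4 / n + INR 3) by (simpl; ring).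
  replace (4 / n + 2) with (4 / n + INR 2) by (simpl; ring).
  rewrite !Rpower_plus_nat by exact Hy.
  generalize (Rpower y (4 / n)). generalize (Rpower (g (1 / y)) n).
  generalize (g (1 / y)). generalize (Derive g (1 / y)).
  generalize (Derive phi (1 / y)).
  intros p g1 g0 G Y. simpl. field.
  split; [ lra | exact Hn ].
Qed.

(** * Transport of solutions *)

Lemma satisfies_on_inversion (n : R) (D D' : R * R -> Prop)
    (u v : R -> R -> R) :
  n <> 0 -> open D' ->
  (forall y s, D' (y, s) -> 0 < y /\ D (1 / y, s)) ->
  (forall y s, D' (y, s) -> v y s = Rpower y (4 / n) * u (1 / y) s) ->
  satisfies_on D (diffusion_equation n (- ((3 * n + 4) / n))) u ->
  satisfies_on D' (diffusion_equation n (- ((3 * n + 4) / n))) v.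
Proof.
  intros Hn HD' Hinv Hv [Su [Pu Eu]].
  assert (Hw : forall y s, D' (y, s) ->
    weighted_inversion 1 (4 / n) (fun z => u z s) y = v y s).
  { intros y s H. rewrite (Hv y s H). unfold weighted_inversion. ring. }
  split; [| split].
  - intros y s H k.
    apply (ex_diff_n_ext_loc
      (fun y s => weighted_inversion 1 (4 / n) (fun z => u z s) y)).
    + eapply locally_2d_impl; [| exact (locally_2d_open D' y s HD' H) ].
      apply locally_2d_forall. exact Hw.
    + apply (ex_diff_n_weighted_inversion D D' k HD' Hinv); [| exact H ].
      intros x t Hxt. exact (Su x t Hxt k).
  - intros y s H. rewrite (Hv y s H).
    apply Rmult_lt_0_compat; [ apply Rpower_pos | apply Pu, Hinv, H ].
  - intros y s H. destruct (Hinv y s H) as [Hy HD].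
    change (Dt v y s
      = spatial_operator n (- ((3 * n + 4) / n)) (fun z => v z s) y).
    assert (HDt : Dt v y s = Rpower y (4 / n) * Dt u (1 / y) s).
    { unfold Dt. rewrite <- Derive_scal. apply Derive_ext_loc.
      generalize (locally_2d_1d_const_x _ _ _ (locally_2d_open D' y s HD' H)).
      apply filter_imp. intros z Hz. exact (Hv y z Hz). }
    rewrite HDt, (Eu _ _ HD).
    rewrite (spatial_operator_ext_loc _ _ _
      (weighted_inversion 1 (4 / n) (fun z => u z s)) y).
    + symmetry. apply spatial_operator_inversion; [ exact Hn | |].
      * generalize (locally_slice D' y s HD' H). apply filter_imp.
        intros z Hz. destruct (Hinv z s Hz) as [Hz0 HDz].
        split; [ exact Hz0 |]. split; [ exact (Pu _ _ HDz) |].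
        exact (proj1 (proj2 (Su _ _ HDz 1%nat))).
      * apply (Su _ _ HD 2%nat).
    + generalize (locally_slice D' y s HD' H). apply filter_imp.
      intros z Hz. symmetry. exact (Hw z s Hz).
Qed.

Lemma inversion_cyclic (n : R) :
  generates_cyclic_group_of_order_2 (inversion n).
Proof.
  split; [| split].
  - intros [[x t] u] [Hx Hu]. split.
    + exact (one_div_pos x Hx).
    + apply Rmult_lt_0_compat; [ apply Rpower_pos | exact Hu ].
  - exists (2, 0, 1). split; [ simpl; lra |].
    intros H. injection H as H _. lra.
  - intros [[x t] u] [Hx Hu]. simpl.
    rewrite (one_div_involutive x Hx), (Rpower_inv x (4 / n) Hx).
    rewrite <- Rmult_assoc, <- Rpower_plus.
    replace (4 / n + - (4 / n)) with 0 by ring.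
    rewrite Rpower_O, Rmult_1_l by exact Hx. reflexivity.
Qed.

Theorem mainTheorem6 (n mu : R) (hn1 : n <> -1) (hn0 : n <> 0)
    (hmu : mu = - ((3 * n + 4) / n)) :
  generates_cyclic_group_of_order_2 (inversion n) /\
  maps_equation_into (inversion n)
    (diffusion_equation n mu) (diffusion_equation n mu).
Proof.
  split; [ apply inversion_cyclic |].
  intros D D' u u' HD HD' Hpos Hdiff _ _ Hu'. subst mu.
  destruct Hdiff as [_ [_ [Hto [A [B [_ [_ [Hfrom [_ Hback]]]]]]]]].
  simpl in Hto, Hback, Hu'.
  (* Surjectivity of the diffeomorphism forces D' to be the image of D under
     (x, t) |-> (1/x, t). *)
  assert (Hinv : forall y s, D' (y, s) -> 0 < y /\ D (1 / y, s)).
  { intros y s H. assert (HA := Hfrom y s H).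
    destruct (Hback y s H) as [Ey Es].
    assert (A0 := Hpos _ _ HA). rewrite <- Ey at 1 2. rewrite <- Es at 3.
    split; [ exact (one_div_pos _ A0) |].
    rewrite (one_div_involutive _ A0). exact HA. }
  split; intros Hsat.
  - apply (satisfies_on_inversion n D' D u' u hn0 HD); [| | exact Hsat ].
    + intros x t H. exact (conj (Hpos x t H) (Hto x t H)).
    + intros x t H. rewrite (Hu' x t H), <- Rmult_assoc, <- Rpower_plus.
      replace (4 / n + - (4 / n)) with 0 by ring.
      rewrite Rpower_O by exact (Hpos x t H). ring.
  - apply (satisfies_on_inversion n D D' u u' hn0 HD' Hinv); [| exact Hsat ].
    intros y s H. destruct (Hinv y s H) as [Hy HDy].
    assert (E := Hu' _ _ HDy).
    rewrite (one_div_involutive y Hy), (Rpower_inv y (4 / n) Hy) in E.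
    exact E.
Qed.
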